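(* Let $n\geq 2$ and let $\mathcal{M}$ be an $n$-cluster tilting subcategory of $\mathcal{B}$. Then $${}^{\bot_{n-2}}\mathcal{M}=\mathcal{M}_L\quad\text{and}\quad\mathcal{M}^{\bot_{n-2}}=\mathcal{M}_R.$$
   Context: $k$ is a field and $\mathcal{B}$ is a $k$-linear, Hom-finite, Krull-Schmidt exact category (in the sense of Quillen) with enough projectives and enough injectives. All subcategories are full. A subcategory $\mathcal{M}$ is contravariantly (resp. covariantly) finite if every $B\in\mathcal{B}$ admits a morphism $M\to B$ (resp. $B\to M$) with $M\in\mathcal{M}$ through which every morphism from $\mathcal{M}$ to $B$ (resp. from $B$ to $\mathcal{M}$) factors. $\mathcal{M}$ is $n$-cluster tilting if: (1) it is contravariantly finite and covariantly finite; (2) $X\in\mathcal{M}$ if and only if $\operatorname{Ext}^i_{\mathcal{B}}(X,\mathcal{M})=0$ for all $i\in\{1,\dots,n-1\}$; (3) $X\in\mathcal{M}$ if and only if $\operatorname{Ext}^i_{\mathcal{B}}(\mathcal{M},X)=0$ for all $i\in\{1,\dots,n-1\}$. ${}^{\bot_{n-2}}\mathcal{M}=\{X\in\mathcal{B}\mid\forall i\in\{1,\dots,n-2\},\ \operatorname{Ext}^i_{\mathcal{B}}(X,\mathcal{M})=0\}$ and $\mathcal{M}^{\bot_{n-2}}=\{X\in\mathcal{B}\mid\forall i\in\{1,\dots,n-2\},\ \operatorname{Ext}^i_{\mathcal{B}}(\mathcal{M},X)=0\}$ (both equal $\mathcal{B}$ for $n=2$). $\mathcal{M}_L$ (resp.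 $\mathcal{M}_R$) is the full subcategory of objects $X$ admitting a short exact sequence $0\to X\to M^0\to M^1\to0$ (resp. $0\to M_1\to M_0\to X\to0$) with $M^0,M^1,M_0,M_1\in\mathcal{M}$. *)

(* Defs.v *)
From HB Require Import structures.
From mathcomp Require Import all_boot all_algebra.
From mathcomp Require Import boolp classical_sets.

Set Implicit Arguments.
Unset Strict Implicit.
Unset Printing Implicit Defensive.

Import GRing.Theory.
Local Open Scope ring_scope.

Declare Scope cat_scope.
Delimit Scope cat_scope with cat.
Local Open Scope cat_scope.

(* Hom-finiteness is built in: a [vectType k] is a finite-dimensional
   k-vector space. *)
Record linCategory (k : fieldType) := LinCategory {
  Ob :> Type;
  Hom : Ob -> Ob -> vectType k;
  idm : forall A : Ob, Hom A A;
  comp : forall A B C : Ob, Hom B C -> Hom A B -> Hom A C;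
  compA : forall (A B C D : Ob) (h : Hom C D) (g : Hom B C) (f : Hom A B),
    comp h (comp g f) = comp (comp h g) f;
  comp1m : forall (A B : Ob) (f : Hom A B), comp (idm B) f = f;
  compm1 : forall (A B : Ob) (f : Hom A B), comp f (idm A) = f;
  comp_linear_l : forall (A B C : Ob) (f : Hom A B),
    linear (fun g : Hom B C => comp g f);
  comp_linear_r : forall (A B C : Ob) (g : Hom B C),
    linear (fun f : Hom A B => comp g f)
}.

Arguments Hom {k l} A B.
Arguments idm {k l} A.
Arguments comp {k l A B C} g f.

Notation "g ∘ f" := (comp g f) (at level 40, left associativity) : cat_scope.

Section LinCategory.
Variables (k : fieldType) (C : linCategory k).
Implicit Types A B X Y : C.

Definition is_iso A B (f : Hom A B) : Prop :=
  exists g : Hom B A, g ∘ f = idm A /\ f ∘ g = idm B.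

Definition has_zero_object : Prop :=
  exists Z : C, forall X,
    (forall f : Hom Z X, f = 0) /\ (forall f : Hom X Z, f = 0).

Definition has_biproducts : Prop :=
  forall A B, exists (S : C) (i1 : Hom A S) (i2 : Hom B S)
                     (p1 : Hom S A) (p2 : Hom S B),
    [/\ p1 ∘ i1 = idm A, p2 ∘ i2 = idm B, p1 ∘ i2 = 0, p2 ∘ i1 = 0
      & i1 ∘ p1 + i2 ∘ p2 = idm S].

(* [m = 0] is allowed and says that [X] is a zero object. *)
Definition is_direct_sum (m : nat) (Y : 'I_m -> C) X : Prop :=
  exists (inj : forall i, Hom (Y i) X) (proj : forall i, Hom X (Y i)),
    [/\ forall i, proj i ∘ inj i = idm (Y i),
        forall i j, i != j -> proj i ∘ inj j = 0
      & \sum_(i < m) inj i ∘ proj i = idm X].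

(* The ring End(X) is local: it is nonzero and its non-units are closed under
   addition. *)
Definition local_endomorphism_ring X : Prop :=
  idm X <> 0 /\
  (forall f g : Hom X X, ~ is_iso f -> ~ is_iso g -> ~ is_iso (f + g)).

Definition Krull_Schmidt : Prop :=
  forall X, exists (m : nat) (Y : 'I_m -> C),
    is_direct_sum Y X /\ (forall i, local_endomorphism_ring (Y i)).

Definition is_kernel A B D (f : Hom A B) (g : Hom B D) : Prop :=
  g ∘ f = 0 /\
  forall T (h : Hom T B), g ∘ h = 0 -> exists! u : Hom T A, f ∘ u = h.

Definition is_cokernel A B D (f : Hom A B) (g : Hom B D) : Prop :=
  g ∘ f = 0 /\
  forall T (h : Hom B T), h ∘ f = 0 -> exists! u : Hom D T, u ∘ g = h.

(*  A --f--> B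
    |a       |b
    A' -f'-> B'   *)
Definition is_pushout A B A' B' (f : Hom A B) (a : Hom A A')
    (f' : Hom A' B') (b : Hom B B') : Prop :=
  b ∘ f = f' ∘ a /\
  forall T (u : Hom B T) (v : Hom A' T), u ∘ f = v ∘ a ->
    exists! w : Hom B' T, w ∘ b = u /\ w ∘ f' = v.

(*  A' -f'-> B'
    |a       |b
    A --f--> B   *)
Definition is_pullback A B A' B' (f : Hom A B) (b : Hom B' B)
    (f' : Hom A' B') (a : Hom A' A) : Prop :=
  b ∘ f' = f ∘ a /\
  forall T (u : Hom T B') (v : Hom T A), b ∘ u = f ∘ v ->
    exists! w : Hom T A', f' ∘ w = u /\ a ∘ w = v.

Definition contravariantly_finite (M : set C) : Prop :=
  forall X, exists (M0 : C) (f : Hom M0 X), M M0 /\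
    forall (M' : C) (g : Hom M' X), M M' -> exists h : Hom M' M0, g = f ∘ h.

Definition covariantly_finite (M : set C) : Prop :=
  forall X, exists (M0 : C) (f : Hom X M0), M M0 /\
    forall (M' : C) (g : Hom X M'), M M' -> exists h : Hom M0 M', g = h ∘ f.

End LinCategory.

Section Classes.
Variables (k : fieldType) (C : linCategory k).
Variable E : forall X Y Z : C, Hom X Y -> Hom Y Z -> Prop.

Definition admissible_mono A B (f : Hom A B) : Prop :=
  exists (D : C) (g : Hom B D), E f g.
Definition admissible_epi B D (g : Hom B D) : Prop :=
  exists (A : C) (f : Hom A B), E f g.

End Classes.

(* [conflation f g] says that 0 -> A -f-> B -g-> D -> 0 is one of the short
   exact sequences of the exact structure.  The axioms are Quillen's, in the
   form of Keller and Buehler. *)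
Record exactCategory (k : fieldType) := ExactCategory {
  underlying :> linCategory k;
  ex_zero : has_zero_object underlying;
  ex_biproducts : has_biproducts underlying;
  conflation : forall A B D : underlying, Hom A B -> Hom B D -> Prop;
  conflation_kernel : forall (A B D : underlying) (f : Hom A B) (g : Hom B D),
    conflation f g -> is_kernel f g;
  conflation_cokernel : forall (A B D : underlying) (f : Hom A B) (g : Hom B D),
    conflation f g -> is_cokernel f g;
  conflation_iso : forall (A B D A' B' D' : underlying)
      (f : Hom A B) (g : Hom B D) (f' : Hom A' B') (g' : Hom B' D')
      (a : Hom A A') (b : Hom B B') (d : Hom D D'),
    is_iso a -> is_iso b -> is_iso d ->
    b ∘ f = f' ∘ a -> d ∘ g = g' ∘ b -> conflation f g -> conflation f' g';
  mono_id : forall A : underlying, admissible_mono conflation (idm A);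
  epi_id : forall A : underlying, admissible_epi conflation (idm A);
  mono_comp : forall (A B D : underlying) (f : Hom A B) (g : Hom B D),
    admissible_mono conflation f -> admissible_mono conflation g ->
    admissible_mono conflation (g ∘ f);
  epi_comp : forall (A B D : underlying) (f : Hom A B) (g : Hom B D),
    admissible_epi conflation f -> admissible_epi conflation g ->
    admissible_epi conflation (g ∘ f);
  mono_pushout : forall (A B A' : underlying) (f : Hom A B) (a : Hom A A'),
    admissible_mono conflation f ->
    exists (B' : underlying) (f' : Hom A' B') (b : Hom B B'),
      is_pushout f a f' b /\ admissible_mono conflation f';
  epi_pullback : forall (A B B' : underlying) (f : Hom A B) (b : Hom B' B),
    admissible_epi conflation f ->
    exists (A' : underlying) (f' : Hom A' B') (a : Hom A' A),
      is_pullback f b f' a /\ admissible_epi conflation f'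
}.

Arguments conflation {k e A B D} f g.

Section ExactCategory.
Variables (k : fieldType) (B : exactCategory k).
Implicit Types P I X Y Z : B.

Definition inflation X Y (f : Hom X Y) : Prop :=
  admissible_mono (@conflation k B) f.
Definition deflation X Y (f : Hom X Y) : Prop :=
  admissible_epi (@conflation k B) f.

Definition projective P : Prop :=
  forall Y Z (p : Hom Y Z) (f : Hom P Z), deflation p ->
    exists h : Hom P Y, p ∘ h = f.

Definition injective_object I : Prop :=
  forall X Y (j : Hom X Y) (f : Hom X I), inflation j ->
    exists h : Hom Y I, h ∘ j = f.

Definition enough_projectives : Prop :=
  forall X, exists (P : B) (p : Hom P X), projective P /\ deflation p.

Definition enough_injectives : Prop :=
  forall X, exists (I : B) (j : Hom X I), injective_object I /\ inflation j.

Record proj_presentation X := ProjPresentation {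
  pp_syz : B;
  pp_cover : B;
  pp_incl : Hom pp_syz pp_cover;
  pp_proj : Hom pp_cover X;
  pp_projective : projective pp_cover;
  pp_conflation : conflation pp_incl pp_proj
}.

Lemma proj_presentation_exists :
  enough_projectives -> forall X, exists _ : proj_presentation X, True.
Proof.
move=> hP X; have [P [p [projP [K [i ip]]]]] := hP X.
by exists (ProjPresentation projP ip).
Qed.

Definition precomp X Y Z (f : Hom X Y) (g : Hom Y Z) : Hom X Z := g ∘ f.

HB.instance Definition _ X Y Z (f : Hom X Y) :=
  GRing.isLinear.Build k (Hom Y Z) (Hom X Z) *:%R (@precomp X Y Z f)
    (@comp_linear_l k B X Y Z f).

End ExactCategory.

(* Ext^i(X, Y) is the i-th right derived functor of Hom(-, Y) at X, i.e. the
   i-th cohomology of Hom(P_*, Y), where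
     ... --> P_2 --> P_1 --> P_0 --> X
   is the projective resolution spliced from chosen conflations
   Omega^(i+1) X --> P_i --> Omega^i X. *)
Section Ext.
Variables (k : fieldType) (B : exactCategory k) (hP : enough_projectives B).
Implicit Types X Y : B.

Definition presentation X : proj_presentation X :=
  sval (cid (proj_presentation_exists hP X)).

Definition syzygy X : B := pp_syz (presentation X).

Definition res_obj X (i : nat) : B :=
  pp_cover (presentation (iter i syzygy X)).

Definition res_diff X (i : nat) : Hom (res_obj X i.+1) (res_obj X i) :=
  pp_incl (presentation (iter i syzygy X)) ∘
  pp_proj (presentation (iter i.+1 syzygy X)).

Definition codiff X Y (i : nat) :
    'Hom(Hom (res_obj X i) Y, Hom (res_obj X i.+1) Y) :=
  linfun (precomp (res_diff X i)).

Definition cocycles X Y (i : nat) : {vspace Hom (res_obj X i) Y} :=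
  lker (codiff X Y i).

Definition coboundaries X Y (i : nat) : {vspace Hom (res_obj X i) Y} :=
  match i return {vspace Hom (res_obj X i) Y} with
  | 0 => 0%VS
  | j.+1 => limg (codiff X Y j)
  end.

(* The coboundaries as a subspace of the space of cocycles. *)
Definition coboundaries_in_cocycles X Y (i : nat) :
    {vspace subvs_of (cocycles X Y i)} :=
  (linfun (vsval : subvs_of (cocycles X Y i) -> _)
     @^-1: coboundaries X Y i)%VS.

(* Despite its name, [{ideal_quot S}] is the quotient of a zmodType by an
   arbitrary additive subgroup S. *)
Definition Ext (i : nat) X Y : zmodType :=
  {ideal_quot (coboundaries_in_cocycles X Y i)}.

Definition Ext_vanishes (i : nat) X Y : Prop := forall e : Ext i X Y, e = 0.

Definition left_perp (m : nat) (M : set B) : set B :=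
  fun X => forall i : nat, (1 <= i <= m)%N ->
    forall Y, M Y -> Ext_vanishes i X Y.

Definition right_perp (m : nat) (M : set B) : set B :=
  fun X => forall i : nat, (1 <= i <= m)%N ->
    forall Y, M Y -> Ext_vanishes i Y X.

Record cluster_tilting (n : nat) (M : set B) : Prop := ClusterTilting {
  ct_contravariantly_finite : contravariantly_finite M;
  ct_covariantly_finite : covariantly_finite M;
  ct_left : forall X, M X <-> left_perp (n - 1) M X;
  ct_right : forall X, M X <-> right_perp (n - 1) M X
}.

End Ext.

Section CopresentedSubcategories.
Variables (k : fieldType) (B : exactCategory k) (M : set B).

Definition ML : set B := fun X =>
  exists (M0 M1 : B) (f : Hom X M0) (g : Hom M0 M1),
    [/\ M M0, M M1 & conflation f g].

Definition MR : set B := fun X =>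
  exists (M0 M1 : B) (f : Hom M1 M0) (g : Hom M0 X),
    [/\ M M0, M M1 & conflation f g].

End CopresentedSubcategories.

(* Main.v *)
(* Write Omega for syzygies and Sigma for cosyzygies.  Dimension shifting gives
   Ext^(i+1)(X, Y) = Ext^1(Omega^i X, Y) = Ext^1(X, Sigma^i Y), so only
   extensions (the vanishing of Ext^1, i.e. splitting) and the low-degree part
   of the long exact sequences are needed.  If 0 -> X -> M^0 -> M^1 -> 0 is
   exact, then Ext^i(X, W) lies between Ext^i(M^0, W) and Ext^(i+1)(M^1, W).
   Conversely, let f : X -> M^0 be a left M-approximation and j : X -> I an
   inflation into an injective; injectives lie in M, so (f, j) : X -> M^0 + I is
   a left M-approximation and an inflation, and the long exact sequence puts its
   cokernel in M.  The second equality is the first one in the opposite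
   category. *)
Require Import Defs.
From mathcomp Require Import all_boot all_algebra.
From mathcomp Require Import boolp classical_sets.
(* [all_algebra] shadows [Hom] and [comp]. *)
Import Defs.

Set Implicit Arguments.
Unset Strict Implicit.
Unset Printing Implicit Defensive.

Import GRing.Theory.
Local Open Scope ring_scope.
Local Open Scope cat_scope.

(** * Bilinearity of composition and the opposite linear category *)

Section LinearCategory.
Variables (k : fieldType) (C : linCategory k).
Implicit Types X Y Z : C.

Lemma compDl X Y Z (g h : Hom Y Z) (f : Hom X Y) :
  (g + h) ∘ f = g ∘ f + h ∘ f.
Proof. by have := comp_linear_l f 1 g h; rewrite !scale1r. Qed.

Lemma compDr X Y Z (g : Hom Y Z) (f h : Hom X Y) :
  g ∘ (f + h) = g ∘ f + g ∘ h.
Proof. by have := comp_linear_r g 1 f h; rewrite !scale1r. Qed.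

Lemma comp0m X Y Z (f : Hom X Y) : (0 : Hom Y Z) ∘ f = 0.
Proof. by apply: (addrI (0 ∘ f)); rewrite -compDl !addr0. Qed.

Lemma compm0 X Y Z (g : Hom Y Z) : g ∘ (0 : Hom X Y) = 0.
Proof. by apply: (addrI (g ∘ 0)); rewrite -compDr !addr0. Qed.

Lemma compNl X Y Z (g : Hom Y Z) (f : Hom X Y) : (- g) ∘ f = - (g ∘ f).
Proof. by apply: (addrI (g ∘ f)); rewrite -compDl !subrr comp0m. Qed.

Lemma compNr X Y Z (g : Hom Y Z) (f : Hom X Y) : g ∘ (- f) = - (g ∘ f).
Proof. by apply: (addrI (g ∘ f)); rewrite -compDr !subrr compm0. Qed.

Lemma is_iso_id X : is_iso (idm X).
Proof. by exists (idm X); rewrite comp1m. Qed.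

Lemma cokernel_epi X Y Z T (f : Hom X Y) (g : Hom Y Z) (u v : Hom Z T) :
  is_cokernel f g -> u ∘ g = v ∘ g -> u = v.
Proof.
move=> [gf0 cok] uv.
have [|w [_ w_uniq]] := cok T (u ∘ g); first by rewrite -compA gf0 compm0.
by rewrite -(w_uniq u) // -(w_uniq v).
Qed.

Lemma kernel_mono X Y Z T (f : Hom X Y) (g : Hom Y Z) (u v : Hom T X) :
  is_kernel f g -> f ∘ u = f ∘ v -> u = v.
Proof.
move=> [gf0 ker] uv.
have [|w [_ w_uniq]] := ker T (f ∘ u); first by rewrite compA gf0 comp0m.
by rewrite -(w_uniq u) // -(w_uniq v).
Qed.

(** Sums are handled through this universal property because the sum in [inflation_pair] arises as a
    pushout. *)
Definition is_coproduct X Y Z (i : Hom X Z) (j : Hom Y Z) : Prop :=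
  forall T (u : Hom X T) (v : Hom Y T),
    exists! w : Hom Z T, w ∘ i = u /\ w ∘ j = v.

Definition linear_op : linCategory k :=
  @LinCategory k C (fun X Y => @Hom k C Y X) (@idm k C)
    (fun _ _ _ g f => f ∘ g)
    (fun _ _ _ _ h g f => esym (compA f g h))
    (fun _ _ f => compm1 f) (fun _ _ f => comp1m f)
    (fun _ _ _ f => comp_linear_r f) (fun _ _ _ g => comp_linear_l g).

Lemma is_iso_op X Y (f : Hom X Y) : @is_iso k linear_op Y X f <-> is_iso f.
Proof. by split=> -[g [gf fg]]; exists g; split. Qed.

End LinearCategory.

(** * The opposite exact structure *)

Section Opposite.
Variables (k : fieldType) (B : exactCategory k).

Definition conflation_op (X Y Z : linear_op B) (f : Hom X Y) (g : Hom Y Z) :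
  Prop := @conflation k B Z Y X g f.

Lemma mono_pushout_op (X Y X' : linear_op B) (f : Hom X Y) (a : Hom X X') :
  admissible_mono conflation_op f ->
  exists (Y' : linear_op B) (f' : Hom X' Y') (b : Hom Y Y'),
    is_pushout f a f' b /\ admissible_mono conflation_op f'.
Proof.
move=> hf; have [A' [f' [b [[sq univ] hf']]]] := @epi_pullback k B Y X X' f a hf.
exists A', f', b; split=> //; split; first by rewrite /= -sq.
move=> T u v uv; have [|w [[w1 w2] w_uniq]] := univ T v u; first exact: esym uv.
by exists w; split=> [//|w' [? ?]]; apply: w_uniq.
Qed.

Lemma epi_pullback_op (X Y Y' : linear_op B) (f : Hom X Y) (b : Hom Y' Y) :
  admissible_epi conflation_op f ->
  exists (X' : linear_op B) (f' : Hom X' Y') (a : Hom X' X),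
    is_pullback f b f' a /\ admissible_epi conflation_op f'.
Proof.
move=> hf; have [A' [f' [a [[sq univ] hf']]]] := @mono_pushout k B Y X Y' f b hf.
exists A', f', a; split=> //; split; first by rewrite /= -sq.
move=> T u v uv; have [|w [[w1 w2] w_uniq]] := univ T v u; first exact: esym uv.
by exists w; split=> [//|w' [? ?]]; apply: w_uniq.
Qed.

(** Left transparent, so that statements about [exact_op B] convert to statements about [B] with
    arrows reversed. *)
Definition exact_op : exactCategory k.
Proof.
apply: (@ExactCategory k (linear_op B) _ _ conflation_op).
- have [Z hZ] := ex_zero B.
  by exists Z => X; have [? ?] := hZ X.
- move=> X Y; have [S [i1 [i2 [p1 [p2 [e1 e2 e3 e4 e5]]]]]] := ex_biproducts X Y.
  by exists S, p1, p2, i1, i2; split.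
- by move=> X Y Z f g /conflation_cokernel.
- by move=> X Y Z f g /conflation_kernel.
- move=> X Y Z X' Y' Z' f g f' g' a b d.
  move=> /is_iso_op[a' [aa a'a]] /is_iso_op[b' [bb b'b]] /is_iso_op[d' [dd d'd]].
  rewrite /= => e1 e2.
  (* Reversing arrows also reverses the comparison isomorphisms, hence the inverses. *)
  apply: (@conflation_iso k B _ _ _ _ _ _ g f g' f' d' b' a').
  + by exists d.
  + by exists b.
  + by exists a.
  + rewrite -[RHS]comp1m -bb -compA; congr (_ ∘ _).
    by rewrite compA -e2 -compA d'd compm1.
  + rewrite -[RHS]comp1m -aa -compA; congr (_ ∘ _).
    by rewrite compA -e1 -compA b'b compm1.
- exact: (@epi_id k B).
- exact: (@mono_id k B).
- by move=> X Y Z f g hf hg; apply: (@epi_comp k B).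
- by move=> X Y Z f g hf hg; apply: (@mono_comp k B).
- exact: mono_pushout_op.
- exact: epi_pullback_op.
Defined.

End Opposite.

(* Yoneda form of the vanishing of Ext^1(X, Y); unlike the definition by
   projective resolutions, it is visibly self-dual. *)
Definition splits (k : fieldType) (B : exactCategory k) (X Y : B) : Prop :=
  forall (E : B) (i : Hom Y E) (p : Hom E X), conflation i p ->
    exists s : Hom X E, p ∘ s = idm X.

(** * Split conflations, extension and lifting *)

Section Splitting.
Variables (k : fieldType) (B : exactCategory k).
Implicit Types A C E I P W X Y Z : B.

(** A section [s] of the deflation [i] of [B] gives a retraction of the inflation [p]: id - s i is
    killed by [i], hence factors through its kernel [p]. *)
Lemma splits_op X Y : splits X Y -> @splits k (exact_op B) Y X.
Proof.
move=> XY E i p ip; have [s ps] := XY E p i ip.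
have ker := @conflation_kernel k B _ _ _ p i ip.
have zero : @comp k B _ _ _ i (idm E - s ∘ i) = 0.
  by rewrite compDr compm1 compNr compA ps comp1m subrr.
have [r [pr _]] := ker.2 _ _ zero.
exists r => /=; apply: (kernel_mono ker).
by rewrite compA pr compDl comp1m compNl -compA (ker.1) compm0 subr0 compm1.
Qed.

(** The axiom only makes [f'] an inflation; its cokernel [c] is identified with [g'] by comparing
    the universal properties of [c], [g] and the pushout. *)
Lemma pushout_conflation A C Z A' (f : Hom A C) (g : Hom C Z) (a : Hom A A') :
  conflation f g ->
  exists (E : B) (f' : Hom A' E) (b : Hom C E) (g' : Hom E Z),
    [/\ is_pushout f a f' b, conflation f' g' & g' ∘ b = g].
Proof.
move=> fg.
have [|E [f' [b [[sq univ] [D [c f'c]]]]]] := @mono_pushout k B _ _ _ f a.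
  by exists Z, g.
have cokg := conflation_cokernel fg; have cokc := conflation_cokernel f'c.
have [|g' [[g'b g'f'] _]] := univ _ g 0; first by rewrite cokg.1 comp0m.
exists E, f', b, g'; split=> //.
have [|w [wg _]] := cokg.2 _ (c ∘ b).
  by rewrite -compA sq compA cokc.1 comp0m.
have [d [dc _]] := cokc.2 _ g' g'f'.
apply: (conflation_iso (is_iso_id _) (is_iso_id _) _ _ _ f'c).
- 2: by rewrite comp1m compm1.
- 2: by rewrite compm1; exact: dc.
exists w; split.
- have [t [_ t_uniq]] : exists! t : Hom E D, t ∘ b = c ∘ b /\ t ∘ f' = 0.
    by apply: univ; rewrite comp0m -compA sq compA cokc.1 comp0m.
  apply: (cokernel_epi cokc); rewrite -compA dc comp1m.
  rewrite -(t_uniq c); last by rewrite cokc.1.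
  by apply/esym/t_uniq; rewrite -!compA g'b wg g'f' compm0.
- by apply: (cokernel_epi cokg); rewrite -compA wg compA dc comp1m g'b.
Qed.

(* Push the conflation out along u and retract it onto Y. *)
Lemma splits_extend X Y A C (f : Hom A C) (g : Hom C X) (u : Hom A Y) :
  splits X Y -> conflation f g -> exists v : Hom C Y, v ∘ f = u.
Proof.
move=> XY fg; have [E [f' [b [g' [[sq _] f'g' _]]]]] := pushout_conflation u fg.
have [r rf'] : exists r : Hom E Y, r ∘ f' = idm Y.
  exact: (@splits_op X Y XY E g' f' f'g').
by exists (r ∘ b); rewrite -compA sq compA rf' comp1m.
Qed.

End Splitting.

Lemma splits_lift (k : fieldType) (B : exactCategory k) (X Y E Z : B)
    (i : Hom Y E) (p : Hom E Z) (u : Hom X Z) :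
  splits X Y -> conflation i p -> exists v : Hom X E, p ∘ v = u.
Proof.
move=> XY ip.
exact: (@splits_extend k (exact_op B) Y X Z E p i u (splits_op XY) ip).
Qed.

(** * Low-degree exact sequences *)

Section Ext1.
Variables (k : fieldType) (B : exactCategory k).
Implicit Types A C D I P W X Y Z : B.

Lemma splits_injective X I : injective_object I -> splits X I.
Proof.
move=> injI E i p ip; have [r ri] := injI _ _ i (idm I)
  (ex_intro _ X (ex_intro _ p ip)).
have cok := conflation_cokernel ip.
have zero : (idm E - i ∘ r) ∘ i = 0.
  by rewrite compDl comp1m compNl -compA ri compm1 subrr.
have [s [sp _]] := cok.2 _ _ zero.
exists s; apply: (cokernel_epi cok).
by rewrite -compA sp compDr compm1 compNr compA cok.1 comp0m subr0 comp1m.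
Qed.

Lemma splits_projective P Y : projective P -> splits P Y.
Proof. by move=> projP E i p ip; apply: projP; exists Y, i. Qed.

(* Hom(C, Y) -> Hom(A, Y) -> Ext^1(D, Y) -> Ext^1(C, Y) *)
Lemma splits_cokernel A C D Y (f : Hom A C) (g : Hom C D) :
  conflation f g -> splits C Y ->
  (forall u : Hom A Y, exists v : Hom C Y, v ∘ f = u) -> splits D Y.
Proof.
move=> fg CY ext E i p ip; have cok := conflation_cokernel fg.
(* The map b f factors through [i] as [a]; correcting [b] by an extension of [a] makes it vanish on
   [A], so it descends to a section. *)
have [b pb] := splits_lift g CY ip.
have [a [ia _]] : exists! a : Hom A Y, i ∘ a = b ∘ f.
  by apply: (conflation_kernel ip).2; rewrite compA pb cok.1.
have [a' a'f] := ext a.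
have [s [sg _]] : exists! s : Hom D E, s ∘ g = b - i ∘ a'.
  by apply: cok.2; rewrite compDl compNl -compA a'f ia subrr.
exists s; apply: (cokernel_epi cok).
by rewrite -compA sg compDr compNr compA (conflation_kernel ip).1 comp0m subr0
   comp1m.
Qed.

End Ext1.

(** * Dimension shifting: [Z] is a cosyzygy of [Y], so [splits D Z] encodes Ext^2(D, Y) = 0 *)

Section DimensionShift.
Variables (k : fieldType) (B : exactCategory k).
Variables (Y I Z : B) (i : Hom Y I) (p : Hom I Z).
Hypotheses (injI : injective_object I) (ip : conflation i p).

(** Hom(X, I) -> Hom(X, Z) -> Ext^1(X, Y) -> Ext^1(X, I) = 0, obtained from [splits_cokernel] in the
    opposite category. *)
Lemma splits_of_lift (X : B) :
  (forall u : Hom X Z, exists v : Hom X I, p ∘ v = u) -> splits X Y.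
Proof.
move=> lift; apply: (@splits_op k (exact_op B) Y X).
apply: (@splits_cokernel k (exact_op B) Z I Y X p i ip) => //.
exact/splits_op/splits_injective.
Qed.

(* Ext^1(C, Y) -> Ext^1(A, Y) -> Ext^2(D, Y) *)
Lemma splits_sub (A C D : B) (f : Hom A C) (g : Hom C D) :
  conflation f g -> splits C Y -> splits D Z -> splits A Y.
Proof.
move=> fg CY DZ; apply: splits_of_lift => u.
have [u' <-] := splits_extend u DZ fg.
by have [v <-] := splits_lift u' CY ip; exists (v ∘ f); rewrite compA.
Qed.

(* Ext^1(A, Y) -> Ext^2(D, Y) -> Ext^2(C, Y) *)
Lemma splits_quotient (A C D : B) (f : Hom A C) (g : Hom C D) :
  conflation f g -> splits A Y -> splits C Z -> splits D Z.
Proof.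
move=> fg AY CZ; apply: (splits_cokernel fg CZ) => u.
have [v <-] := splits_lift u AY ip.
have [v' <-] := injI v (ex_intro _ D (ex_intro _ g fg)).
by exists (p ∘ v'); rewrite compA.
Qed.

(** Both sides encode Ext^2(X, Y) = 0. *)
Lemma splits_shift (X P K : B) (j : Hom K P) (q : Hom P X) :
  projective P -> conflation j q -> splits K Y <-> splits X Z.
Proof.
move=> projP jq; split=> h.
- exact: (splits_quotient jq h (splits_projective projP)).
- exact: (splits_sub jq (splits_projective projP) h).
Qed.

End DimensionShift.

(** * Direct sums *)

Section DirectSums.
Variables (k : fieldType) (B : exactCategory k).
Implicit Types A C I S W X : B.

(** Pushing 0 -> C -> C out along 0 -> A gives a conflation whose middle term is a coproduct of [A]
    and [C], hence isomorphic to [S]. *)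
Lemma biproduct_conflation A C S (i1 : Hom A S) (i2 : Hom C S)
    (p1 : Hom S A) (p2 : Hom S C) :
  p1 ∘ i1 = idm A -> p2 ∘ i2 = idm C -> p1 ∘ i2 = 0 -> p2 ∘ i1 = 0 ->
  i1 ∘ p1 + i2 ∘ p2 = idm S -> conflation i1 p2.
Proof.
move=> p11 p22 p12 p21 sum; have [O [z zC]] := epi_id C.
have z0 : z = 0 by rewrite -[z]comp1m (conflation_kernel zC).1.
have [T [f [b [g [[_ univ] fg gb]]]]] := pushout_conflation (0 : Hom O A) zC.
have [|w [[wb wf] _]] := univ S i2 i1; first by rewrite z0 !compm0.
have [|w' [_ w'_uniq]] := univ T b f; first by rewrite z0 !compm0.
have gf : g ∘ f = 0 by rewrite (conflation_kernel fg).1.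
have wK : (f ∘ p1 + b ∘ p2) ∘ w = idm T.
  rewrite -(w'_uniq (idm T)) ?comp1m //; apply/esym/w'_uniq.
  rewrite -!compA wb wf !compDl -!compA p11 p22 p12 p21 !compm0 !compm1.
  by rewrite add0r addr0.
apply: (conflation_iso (is_iso_id _) _ (is_iso_id _) _ _ fg).
- 2: by rewrite compm1; exact: wf.
- by exists (f ∘ p1 + b ∘ p2); split=> //; rewrite compDr !compA wf wb.
- have gE : g ∘ (f ∘ p1 + b ∘ p2) = p2.
    by rewrite compDr !compA gf comp0m add0r gb comp1m.
  by rewrite comp1m -gE -compA wK compm1.
Qed.

(* (f, j) factors as the graph (f, 1) : X -> A + X, a split inflation, followed
   by 1 + j : A + X -> A + I, which is a pushout of j. *)
Lemma inflation_pair X A I (f : Hom X A) (j : Hom X I) :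
  inflation j ->
  exists (S : B) (i1 : Hom A S) (i2 : Hom I S),
    is_coproduct i1 i2 /\ inflation (i1 ∘ f + i2 ∘ j).
Proof.
move=> infj.
have [T [k1 [k2 [q1 [q2 [e11 e22 e12 e21 sum]]]]]] := ex_biproducts A X.
(* The graph of [f] and [k1] decompose [T] anew, with projections [q2] and q1 - f q2. *)
have cT : conflation (k2 + k1 ∘ f) (q1 - f ∘ q2).
  apply: (@biproduct_conflation X A T _ k1 q2).
  - by rewrite compDr e22 compA e21 comp0m addr0.
  - by rewrite compDl compNl -compA e21 compm0 subr0.
  - exact: e21.
  - rewrite compDl compNl !compDr e12 -compA e22 compm1 compA e11 comp1m add0r.
    by rewrite -compA (compA q2) e21 comp0m compm0 addr0 subrr.
  - by rewrite compDl compDr compNr -compA addrACA subrr addr0 addrC.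
(* Pushing [j] out along [k2] replaces the summand [X] of [T] by [I]. *)
have [S [t [b [[sq univ] inft]]]] := @mono_pushout k B _ _ _ j k2 infj.
exists S, (t ∘ k1), b; split.
- move=> W u v; have [|w [[wb wt] w_uniq]] := univ W v (u ∘ q1 + v ∘ j ∘ q2).
    by rewrite compDl -!compA e12 e22 compm0 add0r compm1.
  exists w; split.
    split=> //; rewrite compA wt compDl -!compA e11 e21 !compm0 compm1.
    by rewrite addr0.
  move=> w' [w'1 w'2]; apply: w_uniq; split=> //.
  by rewrite -w'1 -w'2 -[w' ∘ b ∘ j]compA sq -[LHS]compm1 -sum compDr !compA.
- rewrite sq addrC -compA -compDr; apply: (mono_comp _ inft).
  by exists A, (q1 - f ∘ q2).
Qed.

Lemma splits_coproduct A I S W (i1 : Hom A S) (i2 : Hom I S) :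
  is_coproduct i1 i2 -> splits A W -> splits I W -> splits S W.
Proof.
move=> univ AW IW E i p ip.
have [v1 v1E] := splits_lift i1 AW ip; have [v2 v2E] := splits_lift i2 IW ip.
have [s [[s1 s2] _]] := univ E v1 v2; exists s.
have [w [_ w_uniq]] := univ S i1 i2.
rewrite -(w_uniq (idm S)) ?comp1m //; apply/esym/w_uniq.
by rewrite -!compA s1 s2.
Qed.

End DirectSums.

(** * Objects copresented by [M] *)

Section Copresentation.
Variables (k : fieldType) (B : exactCategory k) (cosyzygy : B -> B).
Hypothesis cosyzygy_conflation : forall Y, exists (I : B) (i : Hom Y I)
  (p : Hom I (cosyzygy Y)), injective_object I /\ conflation i p.

(** Index [i] stands for Ext^(i+1). Degrees reach N + 1 for [M] but N for [X], since the connecting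
    map raises the degree by one. *)
Lemma splits_left_perp_ML (N : nat) (M : set B) (X : B) :
  covariantly_finite M -> (forall I, injective_object I -> M I) ->
  (forall Y, M Y <-> forall i W, (i <= N)%N -> M W ->
     splits Y (iter i cosyzygy W)) ->
  (forall i W, (i < N)%N -> M W -> splits X (iter i cosyzygy W)) <-> ML M X.
Proof.
move=> cov injM hM; split=> [perpX | [M0 [M1 [f [g [M0M M1M fg]]]]] i W iN WM].
- have [M0 [f [M0M approx]]] := cov X.
  have [I [j [q [injI jq]]]] := cosyzygy_conflation X.
  have [|S [i1 [i2 [univ [D [g fg]]]]]] := @inflation_pair _ _ X M0 I f j.
    by exists (cosyzygy X), q.
  have SM : M S.
    apply/hM => i W iN WM; apply: (splits_coproduct univ).
    + exact: (hM M0).1.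
    + exact: ((hM I).1 (injM I injI)).
  (* Ext^1(D, W) vanishes because maps X -> W extend along the approximation; Ext^(i+2)(D, W) lies
     between Ext^(i+1)(X, W) and Ext^(i+2)(S, W). *)
  exists S, D, (i1 ∘ f + i2 ∘ j), g; split=> //; apply/hM => -[|i] W iN WM.
  + apply: (splits_cokernel fg); first exact: (hM S).1 0%N _ iN WM.
    move=> u; have [h uE] := approx _ u WM; have [v [[v1 v2] _]] := univ W h 0.
    by exists v; rewrite compDr !compA v1 v2 comp0m addr0 -uE.
  + have [J [a [b [injJ ab]]]] := cosyzygy_conflation (iter i cosyzygy W).
    apply: (splits_quotient injJ ab fg); first exact: perpX.
    exact: (hM S).1 i.+1 _ iN WM.
- have [J [a [b [injJ ab]]]] := cosyzygy_conflation (iter i cosyzygy W).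
  apply: (splits_sub injJ ab fg); first exact: (hM M0).1 _ _ (ltnW iN) WM.
  exact: (hM M1).1 i.+1 _ iN WM.
Qed.

(** Each step trades the outermost syzygy of [X] for the innermost cosyzygy of [Y], so [Y] varies in
    the induction. *)
Lemma splits_iter_shift (hP : enough_projectives B) (i : nat) (X Y : B) :
  splits (iter i (syzygy hP) X) Y <-> splits X (iter i cosyzygy Y).
Proof.
elim: i Y => [|i IH] Y //.
rewrite (iterSr i cosyzygy); apply: iff_trans (IH _); rewrite iterS.
have [I [j [p [injI jp]]]] := cosyzygy_conflation Y.
set P := presentation hP (iter i (syzygy hP) X).
exact: (splits_shift injI jp (pp_projective (p:=P)) (pp_conflation P)).
Qed.

End Copresentation.

(** * Derived Ext and splitting *)

Lemma ideal_quot_eq0 (R : zmodType) (I : zmodClosed R) (x : R) :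
  (\pi_({ideal_quot I})%qT x == 0) = (x \in I).
Proof. by rewrite -[x in RHS]subr0 Quotient.idealrBE raddf0. Qed.

Section DerivedExt.
Variables (k : fieldType) (B : exactCategory k) (hP : enough_projectives B).

Lemma Ext_vanishesP (i : nat) (X Y : B) :
  Ext_vanishes hP i.+1 X Y <->
  forall f : Hom (res_obj hP X i.+1) Y, f ∘ res_diff hP X i.+1 = 0 ->
    exists g : Hom (res_obj hP X i) Y, f = g ∘ res_diff hP X i.
Proof.
have cobP f : f \in coboundaries hP X Y i.+1 <->
    exists g : Hom (res_obj hP X i) Y, f = g ∘ res_diff hP X i.
  split=> [/memv_imgP[g _ ->]|[g ->]]; first by exists g; rewrite lfunE.
  by apply/memv_imgP; exists g; rewrite ?memvf ?lfunE.
have cocE f : (f \in cocycles hP X Y i.+1) = (f ∘ res_diff hP X i.+1 == 0).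
  by rewrite memv_ker lfunE.
have quotE z : z \in coboundaries_in_cocycles hP X Y i.+1 <->
    exists g : Hom (res_obj hP X i) Y, vsval z = g ∘ res_diff hP X i.
  by rewrite -memv_preim lfunE; exact: cobP.
split=> [van f f0 | ex e].
- have fZ : f \in cocycles hP X Y i.+1 by rewrite cocE f0.
  apply/(quotE (Subvs fZ)).
  by rewrite -ideal_quot_eq0; apply/eqP; exact: van.
- rewrite -[e]reprK; apply/eqP; rewrite ideal_quot_eq0; apply/quotE/ex.
  by apply/eqP; rewrite -cocE; exact: subvsP.
Qed.

(** Cocycles P1 -> Y are the maps u p1 with u : K0 -> Y, and coboundaries those whose [u] extends to
    [P0]; the quotient is Ext^1(X, Y). *)
Lemma cocycles_are_coboundaries_splits (X Y K0 K1 K2 P0 P1 P2 : B)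
    (i0 : Hom K0 P0) (p0 : Hom P0 X) (i1 : Hom K1 P1) (p1 : Hom P1 K0)
    (i2 : Hom K2 P2) (p2 : Hom P2 K1) :
  projective P0 -> conflation i0 p0 -> conflation i1 p1 -> conflation i2 p2 ->
  (forall f : Hom P1 Y, f ∘ (i1 ∘ p2) = 0 ->
     exists g : Hom P0 Y, f = g ∘ (i0 ∘ p1)) <-> splits X Y.
Proof.
move=> projP ip0 ip1 ip2; have cok1 := conflation_cokernel ip1.
split=> [ex | XY f f0].
- apply: (splits_cokernel ip0 (splits_projective projP)) => u.
  have [|g] := ex (u ∘ p1).
    by rewrite -compA (compA p1) cok1.1 comp0m compm0.
  by rewrite compA => /(cokernel_epi cok1) ->; exists g.
- have fi : f ∘ i1 = 0.
    by apply: (cokernel_epi (conflation_cokernel ip2)); rewrite -compA f0 comp0m.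
  have [u [<- _]] := cok1.2 _ _ fi.
  by have [g <-] := splits_extend u XY ip0; exists g; rewrite compA.
Qed.

Lemma Ext_vanishes_splits (i : nat) (X Y : B) :
  Ext_vanishes hP i.+1 X Y <-> splits (iter i (syzygy hP) X) Y.
Proof.
apply: (iff_trans (Ext_vanishesP i X Y)).
set P := presentation hP (iter i (syzygy hP) X).
exact: (cocycles_are_coboundaries_splits Y (pp_projective (p:=P))
  (pp_conflation P) (pp_conflation _) (pp_conflation _)).
Qed.

End DerivedExt.

Theorem proposition3p9 (k : fieldType) (B : exactCategory k)
    (hKS : Krull_Schmidt B)
    (hP : enough_projectives B) (hI : enough_injectives B)
    (n : nat) (hn : (2 <= n)%N)
    (M : set B) (hM : cluster_tilting hP n M) :
  left_perp hP (n - 2) M = ML M /\ right_perp hP (n - 2) M = MR M.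
Proof.
have coszP (Y : B) : exists Z (I : B) (i : Hom Y I) (p : Hom I Z),
    injective_object I /\ conflation i p.
  by have [I [i [injI [Z [p ip]]]]] := hI Y; exists Z, I, i, p.
have [cosz coszE] := choice coszP.
have leftP m X : left_perp hP m M X <->
    forall i W, (i < m)%N -> M W -> splits X (iter i cosz W).
  split=> [h i W im WM | h [//|i] im W WM].
  - exact/(splits_iter_shift coszE hP)/Ext_vanishes_splits/h.
  - exact/Ext_vanishes_splits/(splits_iter_shift coszE hP)/h.
have rightP m X : right_perp hP m M X <->
    forall i W, (i < m)%N -> M W ->
      @splits k (exact_op B) X (iter i (syzygy hP) W).
  split=> [h i W im WM | h [//|i] im W WM].
  - exact/splits_op/Ext_vanishes_splits/h.
  - exact/Ext_vanishes_splits/(@splits_op k (exact_op B) X)/h.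
(* Turns i < n - 1 into i <= N with N = n - 2. *)
have nE : (n - 1 = (n - 2).+1)%N by rewrite -subSn ?subSS.
have injM I : injective_object I -> M I.
  move=> injI; apply/(ct_right hM)/rightP => i W _ _.
  exact/splits_op/splits_injective.
have projM P : projective P -> M P.
  by move=> projP; apply/(ct_left hM)/leftP => i W _ _; exact: splits_projective.
split; apply/predeqP => X.
- apply: (iff_trans (leftP _ X)); apply: (splits_left_perp_ML coszE) => //.
    exact: ct_covariantly_finite hM.
  by move=> Y; rewrite (ct_left hM) nE leftP.
- have MR_op : @ML k (exact_op B) M X <-> MR M X.
    by split=> -[M0 [M1 [f [g ?]]]]; exists M0, M1, g, f.
  apply: (iff_trans (rightP _ X)); apply: iff_trans MR_op.
  apply: (@splits_left_perp_ML k (exact_op B) (syzygy hP)).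
  (* Projective presentations are injective copresentations in the opposite category. *)
  + move=> Y; exists (pp_cover (presentation hP Y)), (pp_proj _), (pp_incl _).
    split; last exact: pp_conflation.
    by move=> U V j f; exact: (@pp_projective _ _ _ (presentation hP Y) V U).
  + exact: ct_contravariantly_finite hM.
  + by move=> P injP; apply: projM => U V p f; exact: injP.
  + by move=> Y; rewrite (ct_right hM) nE rightP.
Qed.
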